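(* Let $(M,f,\xi_1,\xi_2,\eta_1,\eta_2,g)$ be a generalized $S$-space-form, that is, a metric $f$-manifold with two structure vector fields $\xi_1,\xi_2$ together with differentiable functions $F_1,\dots,F_8$ on $M$ such that the Riemannian curvature tensor field $R$ of $(M,g)$ satisfies, for all vector fields $X,Y,Z$ on $M$, \begin{align*} R(X,Y)Z ={}& F_1\{g(Y,Z)X-g(X,Z)Y\}\\ &+F_2\{g(X,fZ)fY-g(Y,fZ)fX+2g(X,fY)fZ\}\\ &+F_3\{\eta_1(X)\eta_1(Z)Y-\eta_1(Y)\eta_1(Z)X+g(X,Z)\eta_1(Y)\xi_1-g(Y,Z)\eta_1(X)\xi_1\}\\ &+F_4\{\eta_2(X)\eta_2(Z)Y-\eta_2(Y)\eta_2(Z)X+g(X,Z)\eta_2(Y)\xi_2-g(Y,Z)\eta_2(X)\xi_2\}\\ &+F_5\{\eta_1(X)\eta_2(Z)Y-\eta_1(Y)\eta_2(Z)X+g(X,Z)\eta_1(Y)\xi_2-g(Y,Z)\eta_1(X)\xi_2\}\\ &+F_6\{\eta_2(X)\eta_1(Z)Y-\eta_2(Y)\eta_1(Z)X+g(X,Z)\eta_2(Y)\xi_1-g(Y,Z)\eta_2(X)\xi_1\}\\ &+F_7\{\eta_1(X)\eta_2(Y)\eta_2(Z)\xi_1-\eta_2(X)\eta_1(Y)\eta_2(Z)\xi_1\}\\ &+F_8\{\eta_2(X)\eta_1(Y)\eta_1(Z)\xi_2-\eta_1(X)\eta_2(Y)\eta_1(Z)\xi_2\}. \end{align*} Then $F_7=F_8$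 (as functions on $M$).
   Context: A metric $f$-manifold with two structure vector fields is a $(2m+2)$-dimensional Riemannian manifold $(M,g)$ endowed with an $f$-structure $f$, i.e. a tensor field $f$ of type $(1,1)$ and rank $2m$ satisfying $f^3+f=0$, and with two global vector fields $\xi_1,\xi_2$ on $M$ (the structure vector fields) such that, if $\eta_1,\eta_2$ are the dual $1$-forms of $\xi_1,\xi_2$ (in particular $\eta_\alpha(\xi_\beta)=\delta_{\alpha\beta}$), then for $\alpha=1,2$ and all vector fields $X,Y$ on $M$: $$f\xi_\alpha=0,\qquad \eta_\alpha\circ f=0,\qquad f^2=-I+\sum_{\alpha=1}^{2}\eta_\alpha\otimes\xi_\alpha,$$ $$g(X,Y)=g(fX,fY)+\sum_{\alpha=1}^{2}\eta_\alpha(X)\eta_\alpha(Y).$$ Here $I$ is the identity endomorphism, $(\eta_\alpha\otimes\xi_\alpha)(X)=\eta_\alpha(X)\xi_\alpha$, and $R$ is the $(1,3)$ curvature tensor of the Levi-Civita connection $\nabla$ of $g$, $R(X,Y)Z=\nabla_X\nabla_YZ-\nabla_Y\nabla_XZ-\nabla_{[X,Y]}Z$. *)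

(* Defs.v *)
From HB Require Import structures.
From mathcomp Require Import all_boot all_order all_algebra.
From mathcomp Require Import ring.
From mathcomp Require Import all_classical all_reals all_analysis.

Set Implicit Arguments.
Unset Strict Implicit.
Unset Printing Implicit Defensive.

Import Order.TTheory GRing.Theory Num.Theory.
Import numFieldNormedType.Exports.

Local Open Scope classical_set_scope.
Local Open Scope ring_scope.

Section SmoothOn.
Context {R : realType} {n : nat}.
Implicit Types (U : set 'rV[R]_n) (h : 'rV[R]_n -> R).

(* Meaningful for open U only: the derivatives are two-sided. *)
Fixpoint Ck_on (k : nat) U h : Prop :=
  (forall x, U x -> {for x, continuous h}) /\
  if k is k'.+1 then
    forall i : 'I_n,
      (forall x, U x -> derivable h x (delta_mx 0 i)) /\
      Ck_on k' U (fun x => 'D_(delta_mx 0 i) h x)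
  else True.

Definition smooth_on U h : Prop := forall k, Ck_on k U h.

Lemma Ck_on_cont k U h : Ck_on k U h ->
  forall x, U x -> {for x, continuous h}.
Proof. by case: k => [|k] []. Qed.

Lemma Ck_onW k U h : Ck_on k.+1 U h -> Ck_on k U h.
Proof.
elim: k h => [|k IH] h [hc hd]; first by split.
by split=> // i; have [? /IH ?] := hd i.
Qed.

Lemma Ck_on_ext k U h h' : open U -> (forall x, U x -> h x = h' x) ->
  Ck_on k U h -> Ck_on k U h'.
Proof.
move=> oU; have nearU (f f' : 'rV[R]_n -> R) x : (forall x, U x -> f x = f' x) ->
    U x -> \forall y \near x, f y = f' y.
  move=> e Ux; have : nbhs x U by apply: open_nbhs_nbhs.
  by apply: filterS => y /e.
have contU (f f' : 'rV[R]_n -> R) : (forall x, U x -> f x = f' x) ->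
    (forall x, U x -> {for x, continuous f}) ->
    forall x, U x -> {for x, continuous f'}.
  move=> e cf x Ux; rewrite /prop_for /continuous_at -(e _ Ux).
  apply: cvg_trans (cf _ Ux); apply: (@near_eq_cvg _ _ (nbhs x)).
  exact: nearU e Ux.
elim: k h h' => [|k IH] h h' e /= [hc hd]; split=> //; try exact: contU hc.
move=> i; have [hdi hki] := hd i.
have nz : delta_mx 0 i != 0 :> 'rV[R]_n.
  apply/eqP => /matrixP /(_ 0 i); rewrite !mxE !eqxx /= => /eqP.
  by rewrite oner_eq0.
split.
  move=> x Ux; apply: near_eq_derivable (hdi _ Ux) => //; exact: nearU.
apply: IH hki => x Ux; apply: near_eq_derive => //; exact: nearU.
Qed.

Lemma Ck_on_cst k U (c : R) : Ck_on k U (cst c).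
Proof.
elim: k c => [|k IH] c; split=> //; try by move=> x _; apply: cst_continuous.
move=> i; split; first by move=> x _; exact: derivable_cst.
rewrite (_ : (fun _ => _) = cst 0); first exact: IH.
by apply/funext => x; rewrite derive_cst.
Qed.

Lemma Ck_onD k U h1 h2 : open U -> Ck_on k U h1 -> Ck_on k U h2 ->
  Ck_on k U (fun x => h1 x + h2 x).
Proof.
move=> oU; elim: k h1 h2 => [|k IH] h1 h2 /= [c1 d1] [c2 d2]; split=> //;
  try by move=> x Ux; apply: continuousD; [exact: c1|exact: c2].
move=> i; have [d1i k1] := d1 i; have [d2i k2] := d2 i; split.
  by move=> x Ux; apply: derivableD; [exact: d1i|exact: d2i].
apply: Ck_on_ext (IH _ _ k1 k2) => // x Ux.
by rewrite -deriveD; [|exact: d1i|exact: d2i].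
Qed.

Lemma Ck_onM k U h1 h2 : open U -> Ck_on k U h1 -> Ck_on k U h2 ->
  Ck_on k U (fun x => h1 x * h2 x).
Proof.
move=> oU; elim: k h1 h2 => [|k IH] h1 h2 H1 H2; have [c1 d1] := H1;
  have [c2 d2] := H2; split=> //;
  try by move=> x Ux; apply: continuousM; [exact: c1|exact: c2].
move=> i; have [d1i k1] := d1 i; have [d2i k2] := d2 i; split.
  by move=> x Ux; apply: derivableM; [exact: d1i|exact: d2i].
have := Ck_onD oU (IH _ _ (Ck_onW H1) k2) (IH _ _ (Ck_onW H2) k1).
apply: Ck_on_ext => // x Ux.
by rewrite deriveM; [|exact: d1i|exact: d2i].
Qed.

End SmoothOn.

(* chart_map and chart_inv are total; only their restrictions to chart_dom and to
   its image matter. *)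
Record chart (R : realType) (n : nat) (T : topologicalType) := Chart {
  chart_dom : set T;
  chart_map : T -> 'rV[R]_n;
  chart_inv : 'rV[R]_n -> T;
  chart_dom_open : open chart_dom;
  chart_img_open : open (chart_map @` chart_dom);
  chart_mapK : forall p, chart_dom p -> chart_inv (chart_map p) = p;
  chart_map_cont : forall p, chart_dom p -> {for p, continuous chart_map};
  chart_inv_cont : forall x, (chart_map @` chart_dom) x ->
    {for x, continuous chart_inv} }.

Definition chart_compatible (R : realType) (n : nat) (T : topologicalType)
    (c d : chart R n T) : Prop :=
  forall i : 'I_n,
    smooth_on (chart_map c @` (chart_dom c `&` chart_dom d))
      (fun x => chart_map d (chart_inv c x) 0 i).

Record manifold (R : realType) (n : nat) := Manifold {
  mcarrier :> topologicalType;
  mhausdorff : hausdorff_space mcarrier;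
  msecond_countable : @second_countable mcarrier;
  atlas : set (chart R n mcarrier);
  atlas_cover : forall p, exists2 c, atlas c & chart_dom c p;
  atlas_compatible : forall c d, atlas c -> atlas d -> chart_compatible c d }.

Definition smooth (R : realType) (n : nat) (M : manifold R n) (h : M -> R) :
    Prop :=
  forall c, @atlas R n M c ->
    smooth_on (chart_map c @` chart_dom c) (fun x => h (chart_inv c x)).

Record smooth_fun (R : realType) (n : nat) (M : manifold R n) := SmoothFun {
  sf_fun :> M -> R;
  sf_smooth : smooth sf_fun }.

Notation "'C^oo' ( M )" := (smooth_fun M) (at level 8, format "'C^oo' ( M )").

Section SmoothFunAlgebra.
Context {R : realType} {n : nat} {M : manifold R n}.
Implicit Types h k l : C^oo(M).

Lemma sf_ext h k : (forall p, h p = k p) -> h = k.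
Proof.
case: h k => [h hP] [k kP] /= e; have {}e : h = k by apply/funext.
by subst k; congr SmoothFun; apply: Prop_irrelevance.
Qed.

Lemma smooth_cst (a : R) : @smooth R n M (fun=> a).
Proof. by move=> c _ i; apply: Ck_on_cst. Qed.

Lemma smoothD (u v : M -> R) : smooth u -> smooth v ->
  smooth (fun p => u p + v p).
Proof.
move=> su sv c ac i.
by apply: Ck_onD; [apply: chart_img_open | apply: su | apply: sv].
Qed.

Lemma smoothM (u v : M -> R) : smooth u -> smooth v ->
  smooth (fun p => u p * v p).
Proof.
move=> su sv c ac i.
by apply: Ck_onM; [apply: chart_img_open | apply: su | apply: sv].
Qed.

Lemma smoothN (u : M -> R) : smooth u -> smooth (fun p => - u p).
Proof.
move=> su; rewrite (_ : (fun _ => _) = fun p => -1 * u p).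
  by apply: smoothM => //; apply: smooth_cst.
by apply/funext => p; rewrite mulN1r.
Qed.

HB.instance Definition _ := gen_eqMixin C^oo(M).
HB.instance Definition _ := gen_choiceMixin C^oo(M).

Definition sf_cst (a : R) : C^oo(M) := SmoothFun (smooth_cst a).
Definition sf_add h k : C^oo(M) := SmoothFun (smoothD (sf_smooth h) (sf_smooth k)).
Definition sf_opp h : C^oo(M) := SmoothFun (smoothN (sf_smooth h)).
Definition sf_mul h k : C^oo(M) := SmoothFun (smoothM (sf_smooth h) (sf_smooth k)).

Fact sf_addA : associative sf_add.
Proof. by move=> h k l; apply: sf_ext => p /=; rewrite addrA. Qed.
Fact sf_addC : commutative sf_add.
Proof. by move=> h k; apply: sf_ext => p /=; rewrite addrC. Qed.
Fact sf_add0 : left_id (sf_cst 0) sf_add.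
Proof. by move=> h; apply: sf_ext => p /=; rewrite add0r. Qed.
Fact sf_addN : left_inverse (sf_cst 0) sf_opp sf_add.
Proof. by move=> h; apply: sf_ext => p /=; rewrite addNr. Qed.

HB.instance Definition _ :=
  GRing.isZmodule.Build C^oo(M) sf_addA sf_addC sf_add0 sf_addN.

Fact sf_mulA : associative sf_mul.
Proof. by move=> h k l; apply: sf_ext => p /=; rewrite mulrA. Qed.
Fact sf_mulC : commutative sf_mul.
Proof. by move=> h k; apply: sf_ext => p /=; rewrite mulrC. Qed.
Fact sf_mul1 : left_id (sf_cst 1) sf_mul.
Proof. by move=> h; apply: sf_ext => p /=; rewrite mul1r. Qed.
Fact sf_mulDl : left_distributive sf_mul +%R.
Proof. by move=> h k l; apply: sf_ext => p /=; rewrite mulrDl. Qed.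

HB.instance Definition _ :=
  GRing.Zmodule_isComPzRing.Build C^oo(M) sf_mulA sf_mulC sf_mul1 sf_mulDl.

Definition sf_scale (a : R) h : C^oo(M) := sf_cst a * h.

Fact sf_scaleA a b h : sf_scale a (sf_scale b h) = sf_scale (a * b) h.
Proof. by apply: sf_ext => p /=; rewrite mulrA. Qed.
Fact sf_scale1 : left_id 1 sf_scale.
Proof. by move=> h; apply: sf_ext => p /=; rewrite mul1r. Qed.
Fact sf_scaleDr : right_distributive sf_scale +%R.
Proof. by move=> a h k; apply: sf_ext => p /=; rewrite mulrDr. Qed.
Fact sf_scaleDl h : {morph sf_scale^~ h : a b / a + b}.
Proof. by move=> a b; apply: sf_ext => p /=; rewrite mulrDl. Qed.

HB.instance Definition _ := GRing.Zmodule_isLmodule.Build R C^oo(M)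
  sf_scaleA sf_scale1 sf_scaleDr sf_scaleDl.

Lemma sfD h k p : (h + k) p = h p + k p. Proof. by []. Qed.
Lemma sfN h p : (- h) p = - h p. Proof. by []. Qed.
Lemma sfM h k p : (h * k) p = h p * k p. Proof. by []. Qed.
Lemma sfZ a h p : (a *: h) p = a * h p. Proof. by []. Qed.
Lemma sf0 p : (0 : C^oo(M)) p = 0. Proof. by []. Qed.
Lemma sf1 p : (1 : C^oo(M)) p = 1. Proof. by []. Qed.

End SmoothFunAlgebra.

(* Tangent vectors at p are the point derivations of C^oo(M) at p. *)
Record tangent (R : realType) (n : nat) (M : manifold R n) (p : M) := Tangent {
  tv_fun :> C^oo(M) -> R;
  tv_linear : forall (a : R) (h k : C^oo(M)),
    tv_fun (a *: h + k) = a * tv_fun h + tv_fun k;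
  tv_leibniz : forall h k : C^oo(M),
    tv_fun (h * k) = tv_fun h * k p + h p * tv_fun k }.

Section TangentSpace.
Context {R : realType} {n : nat} {M : manifold R n} {p : M}.
Local Notation T := (tangent p).
Implicit Types (u v w : T).

Lemma tv_ext u v : (forall h, u h = v h) -> u = v.
Proof.
case: u v => [u u1 u2] [v v1 v2] /= e; have {}e : u = v by apply/funext.
by subst v; congr Tangent; apply: Prop_irrelevance.
Qed.

HB.instance Definition _ := gen_eqMixin T.
HB.instance Definition _ := gen_choiceMixin T.

Program Definition tv_zero : T := @Tangent R n M p (fun=> 0) _ _.
Next Obligation. by move=> a h k /=; rewrite mulr0 addr0. Qed.
Next Obligation. by move=> h k /=; rewrite mul0r mulr0 addr0. Qed.

Program Definition tv_add u v : T := @Tangent R n M p (fun h => u h + v h) _ _.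
Next Obligation. by move=> u v a h k /=; rewrite !tv_linear mulrDr addrACA. Qed.
Next Obligation.
by move=> u v h k /=; rewrite !tv_leibniz mulrDr mulrDl addrACA.
Qed.

Program Definition tv_scale (c : R) u : T :=
  @Tangent R n M p (fun h => c * u h) _ _.
Next Obligation. by move=> c u a h k /=; rewrite tv_linear mulrDr mulrCA. Qed.
Next Obligation.
by move=> c u h k /=; rewrite tv_leibniz mulrDr mulrA [c * (h p * _)]mulrCA.
Qed.

Definition tv_opp u : T := tv_scale (-1) u.

Fact tv_addA : associative tv_add.
Proof. by move=> u v w; apply: tv_ext => h /=; rewrite addrA. Qed.
Fact tv_addC : commutative tv_add.
Proof. by move=> u v; apply: tv_ext => h /=; rewrite addrC. Qed.
Fact tv_add0 : left_id tv_zero tv_add.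
Proof. by move=> u; apply: tv_ext => h /=; rewrite add0r. Qed.
Fact tv_addN : left_inverse tv_zero tv_opp tv_add.
Proof. by move=> u; apply: tv_ext => h /=; rewrite mulN1r addNr. Qed.

HB.instance Definition _ :=
  GRing.isZmodule.Build T tv_addA tv_addC tv_add0 tv_addN.

Fact tv_scaleA a b u : tv_scale a (tv_scale b u) = tv_scale (a * b) u.
Proof. by apply: tv_ext => h /=; rewrite mulrA. Qed.
Fact tv_scale1 : left_id 1 tv_scale.
Proof. by move=> u; apply: tv_ext => h /=; rewrite mul1r. Qed.
Fact tv_scaleDr : right_distributive tv_scale +%R.
Proof. by move=> a u v; apply: tv_ext => h /=; rewrite mulrDr. Qed.
Fact tv_scaleDl u : {morph tv_scale^~ u : a b / a + b}.
Proof. by move=> a b; apply: tv_ext => h /=; rewrite mulrDl. Qed.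

HB.instance Definition _ := GRing.Zmodule_isLmodule.Build R T
  tv_scaleA tv_scale1 tv_scaleDr tv_scaleDl.

Lemma tvD u v h : (u + v) h = u h + v h. Proof. by []. Qed.
Lemma tvN u h : (- u) h = - u h. Proof. exact: mulN1r. Qed.
Lemma tvZ a u h : (a *: u) h = a * u h. Proof. by []. Qed.
Lemma tv0 h : (0 : T) h = 0. Proof. by []. Qed.

End TangentSpace.

Record vector_field (R : realType) (n : nat) (M : manifold R n) := VectorField {
  vf_val :> forall p : M, tangent p;
  vf_smooth : forall h : C^oo(M), smooth (fun p => vf_val p h) }.

Section VectorFields.
Context {R : realType} {n : nat} {M : manifold R n}.
Local Notation X_M := (vector_field M).
Implicit Types (X Y Z : X_M) (h k : C^oo(M)).

Lemma vf_ext X Y : (forall p, X p = Y p) -> X = Y.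
Proof.
case: X Y => [X XP] [Y YP] /= e; have {}e : X = Y by apply: functional_extensionality_dep.
by subst Y; congr VectorField; apply: Prop_irrelevance.
Qed.

HB.instance Definition _ := gen_eqMixin X_M.
HB.instance Definition _ := gen_choiceMixin X_M.

Definition vf_app X h : C^oo(M) := SmoothFun (vf_smooth X h).

Program Definition vf_zero : X_M := @VectorField R n M (fun p => 0) _.
Next Obligation. by move=> h; apply: smooth_cst. Qed.

Program Definition vf_add X Y : X_M :=
  @VectorField R n M (fun p => X p + Y p) _.
Next Obligation. by move=> X Y h; apply: smoothD; apply: vf_smooth. Qed.

Program Definition vf_scale k X : X_M :=
  @VectorField R n M (fun p => k p *: X p) _.
Next Obligation.
by move=> k X h; apply: smoothM; [apply: sf_smooth | apply: vf_smooth].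
Qed.

Definition vf_opp X : X_M := vf_scale (-1) X.

Fact vf_addA : associative vf_add.
Proof. by move=> X Y Z; apply: vf_ext => p /=; rewrite addrA. Qed.
Fact vf_addC : commutative vf_add.
Proof. by move=> X Y; apply: vf_ext => p /=; rewrite addrC. Qed.
Fact vf_add0 : left_id vf_zero vf_add.
Proof. by move=> X; apply: vf_ext => p /=; rewrite add0r. Qed.
Fact vf_addN : left_inverse vf_zero vf_opp vf_add.
Proof. by move=> X; apply: vf_ext => p /=; rewrite scaleN1r addNr. Qed.

HB.instance Definition _ :=
  GRing.isZmodule.Build X_M vf_addA vf_addC vf_add0 vf_addN.

Fact vf_scaleA h k X : vf_scale h (vf_scale k X) = vf_scale (h * k) X.
Proof. by apply: vf_ext => p /=; rewrite scalerA. Qed.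
Fact vf_scale1 : left_id 1 vf_scale.
Proof. by move=> X; apply: vf_ext => p /=; rewrite scale1r. Qed.
Fact vf_scaleDr : right_distributive vf_scale +%R.
Proof. by move=> h X Y; apply: vf_ext => p /=; rewrite scalerDr. Qed.
Fact vf_scaleDl X : {morph vf_scale^~ X : h k / h + k}.
Proof. by move=> h k; apply: vf_ext => p /=; rewrite scalerDl. Qed.

HB.instance Definition _ := GRing.Zmodule_isLmodule.Build C^oo(M) X_M
  vf_scaleA vf_scale1 vf_scaleDr vf_scaleDl.

Lemma vfD X Y p : (X + Y) p = X p + Y p. Proof. by []. Qed.
Lemma vfN X p : (- X) p = - X p. Proof. exact: scaleN1r. Qed.
Lemma vfZ h X p : (h *: X) p = h p *: X p. Proof. by []. Qed.
Lemma vf0 p : (0 : X_M) p = 0. Proof. by []. Qed.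

Program Definition lie_bracket X Y : X_M :=
  @VectorField R n M (fun p =>
    @Tangent R n M p (fun h => X p (vf_app Y h) - Y p (vf_app X h)) _ _) _.
Next Obligation.
move=> X Y p a h k /=.
have appl Z : vf_app Z (a *: h + k) = a *: vf_app Z h + vf_app Z k.
  by apply: sf_ext => q /=; rewrite tv_linear.
by rewrite !appl !tv_linear mulrBr opprD addrACA.
Qed.
Next Obligation.
move=> X Y p h k /=.
have appM Z : vf_app Z (h * k) = 1 *: (vf_app Z h * k) + h * vf_app Z k.
  by apply: sf_ext => q /=; rewrite tv_leibniz mul1r.
rewrite !appM !tv_linear !mul1r !tv_leibniz /=.
ring.
Qed.
Next Obligation.
move=> X Y h; apply: smoothD; first exact: (vf_smooth X (vf_app Y h)).
by apply: smoothN; exact: (vf_smooth Y (vf_app X h)).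
Qed.

End VectorFields.

(* A pointwise linear field is smooth iff it sends smooth fields to smooth
   fields; the same criterion is used for one_form and riemannian_metric. *)
Record tensor11 (R : realType) (n : nat) (M : manifold R n) := Tensor11 {
  t11_val :> forall p : M, {linear tangent p -> tangent p};
  t11_smooth : forall (X : vector_field M) (h : C^oo(M)),
    smooth (fun p => t11_val p (X p) h) }.

Definition t11_app (R : realType) (n : nat) (M : manifold R n)
    (f : tensor11 M) (X : vector_field M) : vector_field M :=
  VectorField (t11_smooth f X).

Definition linear_rank (R : realType) (V W : lmodType R) (f : {linear V -> W})
    (r : nat) : Prop :=
  exists e : 'I_r -> V,
    (forall a : 'I_r -> R, \sum_i a i *: f (e i) = 0 -> forall i, a i = 0) /\
    (forall v, exists a : 'I_r -> R, f v = \sum_i a i *: f (e i)).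

Record one_form (R : realType) (n : nat) (M : manifold R n) := OneForm {
  form_val :> forall p : M, {linear tangent p -> R^o};
  form_smooth : forall X : vector_field M,
    @smooth R n M (fun p => form_val p (X p)) }.

Definition form_app (R : realType) (n : nat) (M : manifold R n)
    (w : one_form M) (X : vector_field M) : C^oo(M) :=
  SmoothFun (form_smooth w X).

Record riemannian_metric (R : realType) (n : nat) (M : manifold R n) :=
    RiemannianMetric {
  riem_val :> forall p : M, tangent p -> tangent p -> R;
  riem_linear : forall (p : M) (a : R) (u v w : tangent p),
    @riem_val p (a *: u + v) w = a * @riem_val p u w + @riem_val p v w;
  riem_sym : forall (p : M) (u v : tangent p),
    @riem_val p u v = @riem_val p v u;
  riem_pos : forall (p : M) (u : tangent p), u != 0 -> 0 < @riem_val p u u;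
  riem_smooth : forall X Y : vector_field M,
    smooth (fun p => @riem_val p (X p) (Y p)) }.

Definition metric_app (R : realType) (n : nat) (M : manifold R n)
    (g : riemannian_metric M) (X Y : vector_field M) : C^oo(M) :=
  SmoothFun (riem_smooth g X Y).

Record levi_civita (R : realType) (n : nat) (M : manifold R n)
    (g : riemannian_metric M)
    (nabla : vector_field M -> vector_field M -> vector_field M) : Prop :=
  LeviCivita {
  lc_linear_l : forall (h : C^oo(M)) (X Y Z : vector_field M),
    nabla (h *: X + Y) Z = h *: nabla X Z + nabla Y Z;
  lc_additive_r : forall X Y Z : vector_field M,
    nabla X (Y + Z) = nabla X Y + nabla X Z;
  lc_leibniz : forall (h : C^oo(M)) (X Y : vector_field M),
    nabla X (h *: Y) = vf_app X h *: Y + h *: nabla X Y;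
  lc_torsion_free : forall X Y : vector_field M,
    nabla X Y - nabla Y X = lie_bracket X Y;
  lc_metric : forall X Y Z : vector_field M,
    vf_app X (metric_app g Y Z) =
    metric_app g (nabla X Y) Z + metric_app g Y (nabla X Z) }.

Definition curvature (R : realType) (n : nat) (M : manifold R n)
    (nabla : vector_field M -> vector_field M -> vector_field M)
    (X Y Z : vector_field M) : vector_field M :=
  nabla X (nabla Y Z) - nabla Y (nabla X Z) - nabla (lie_bracket X Y) Z.

Record metric_f_structure (R : realType) (m : nat)
    (M : manifold R (2 * m + 2)) (f : tensor11 M)
    (xi : 'I_2 -> vector_field M) (eta : 'I_2 -> one_form M)
    (g : riemannian_metric M) : Prop := MetricFStructure {
  mf_rank : forall p : M, linear_rank (f p) (2 * m);
  mf_cube : forall X : vector_field M,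
    t11_app f (t11_app f (t11_app f X)) + t11_app f X = 0;
  mf_dual : forall a b : 'I_2, form_app (eta a) (xi b) = (a == b)%:R;
  mf_f_xi : forall a : 'I_2, t11_app f (xi a) = 0;
  mf_eta_f : forall (a : 'I_2) (X : vector_field M),
    form_app (eta a) (t11_app f X) = 0;
  mf_square : forall X : vector_field M,
    t11_app f (t11_app f X) =
    - X + \sum_(a < 2) form_app (eta a) X *: xi a;
  mf_compat : forall X Y : vector_field M,
    metric_app g X Y =
    metric_app g (t11_app f X) (t11_app f Y) +
    \sum_(a < 2) form_app (eta a) X * form_app (eta a) Y }.

(* xi_1, xi_2 and eta_1, eta_2 sit at the indices 0 and 1 of 'I_2. *)
Definition gen_S_space_form_curvature (R : realType) (n : nat)
    (M : manifold R n) (f : tensor11 M) (xi : 'I_2 -> vector_field M)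
    (eta : 'I_2 -> one_form M) (g : riemannian_metric M)
    (F1 F2 F3 F4 F5 F6 F7 F8 : C^oo(M)) (X Y Z : vector_field M) :
    vector_field M :=
  let xi1 := xi 0 in let xi2 := xi 1 in
  let eta1 := form_app (eta 0) in let eta2 := form_app (eta 1) in
  let g := metric_app g in let f := t11_app f in
  F1 *: (g Y Z *: X - g X Z *: Y)
  + F2 *: (g X (f Z) *: f Y - g Y (f Z) *: f X + (2 * g X (f Y)) *: f Z)
  + F3 *: ((eta1 X * eta1 Z) *: Y - (eta1 Y * eta1 Z) *: X
           + (g X Z * eta1 Y) *: xi1 - (g Y Z * eta1 X) *: xi1)
  + F4 *: ((eta2 X * eta2 Z) *: Y - (eta2 Y * eta2 Z) *: X
           + (g X Z * eta2 Y) *: xi2 - (g Y Z * eta2 X) *: xi2)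
  + F5 *: ((eta1 X * eta2 Z) *: Y - (eta1 Y * eta2 Z) *: X
           + (g X Z * eta1 Y) *: xi2 - (g Y Z * eta1 X) *: xi2)
  + F6 *: ((eta2 X * eta1 Z) *: Y - (eta2 Y * eta1 Z) *: X
           + (g X Z * eta2 Y) *: xi1 - (g Y Z * eta2 X) *: xi1)
  + F7 *: ((eta1 X * eta2 Y * eta2 Z) *: xi1 - (eta2 X * eta1 Y * eta2 Z) *: xi1)
  + F8 *: ((eta2 X * eta1 Y * eta1 Z) *: xi2 - (eta1 X * eta2 Y * eta1 Z) *: xi2).

(* Main.v *)
Require Import Defs.
From mathcomp Require Import all_boot all_order all_algebra.
From mathcomp Require Import ring.
From mathcomp Require Import all_classical all_reals all_analysis.

(** The two functions are compared by computing the sectional curvature of the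
    plane spanned by the orthonormal fields xi_1, xi_2 in two ways.

    The curvature endomorphism of a metric connection is skew-adjoint:
    differentiating the function g(Z, W) along X and Y and antisymmetrizing
    gives g(R(X,Y)Z, W) + g(Z, R(X,Y)W) = 0, because the commutator of the
    derivations X and Y is [X,Y] ([curvature_skew]).

    In the space-form expression, all terms containing f vanish on the
    structure fields, and the F_5 and F_6 terms vanish or cancel in pairs, so
    that
      R(xi_1,xi_2)xi_2 = (F_1 - F_3 - F_4 + F_7) xi_1,
      R(xi_1,xi_2)xi_1 = - (F_1 - F_3 - F_4 + F_8) xi_2.
    Skew-adjointness on the pair (xi_2, xi_1) equates the two coefficients.
    The argument is global and algebraic: it takes place in the module of
    vector fields over the ring of smooth functions. *)

Import GRing.Theory.

Local Open Scope ring_scope.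

Section Metric.
Context {R : realType} {n : nat} {M : manifold R n}.
Variable g : riemannian_metric M.
Implicit Types (X Y Z W : vector_field M) (h : C^oo(M)).

Lemma metricC X Y : metric_app g X Y = metric_app g Y X.
Proof. by apply: sf_ext => p; apply: riem_sym. Qed.

Lemma metricDl X Y Z :
  metric_app g (X + Y) Z = metric_app g X Z + metric_app g Y Z.
Proof.
by apply: sf_ext => p /=; rewrite -[X p]scale1r riem_linear mul1r scale1r.
Qed.

Lemma metricZl h X Y : metric_app g (h *: X) Y = h * metric_app g X Y.
Proof.
have g0 p (v : tangent p) : riem_val g 0 v = 0.
  by have /eqP := riem_linear g 1 0 0 v;
     rewrite scaler0 addr0 mul1r -subr_eq subrr => /eqP <-.
by apply: sf_ext => p /=; rewrite -[h p *: X p]addr0 riem_linear g0 addr0.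
Qed.

Lemma metricBl X Y Z :
  metric_app g (X - Y) Z = metric_app g X Z - metric_app g Y Z.
Proof. by rewrite metricDl -scaleN1r metricZl mulN1r. Qed.

Lemma metricBr X Y Z :
  metric_app g X (Y - Z) = metric_app g X Y - metric_app g X Z.
Proof. by rewrite metricC metricBl ![metric_app g _ X]metricC. Qed.

Lemma metric0l X : metric_app g 0 X = 0.
Proof. by rewrite -[0 in LHS](subrr X) metricBl subrr. Qed.

Lemma metric0r X : metric_app g X 0 = 0.
Proof. by rewrite metricC metric0l. Qed.

Lemma vf_appD X h k : vf_app X (h + k) = vf_app X h + vf_app X k.
Proof.
by apply: sf_ext => p /=; rewrite -[h]scale1r tv_linear mul1r scale1r.
Qed.

Lemma vf_app_bracket X Y h :
  vf_app (lie_bracket X Y) h = vf_app X (vf_app Y h) - vf_app Y (vf_app X h).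
Proof. exact: sf_ext. Qed.

(** Expanding X(Y(g(Z,W))) twice by metric compatibility produces the mixed
    products g(nabla_X Z, nabla_Y W) + g(nabla_Y Z, nabla_X W), symmetric in
    X and Y; they drop out of the commutator, and what is left is [X,Y]g(Z,W)
    together with the two curvature terms. *)
Lemma curvature_skew (nabla : vector_field M -> vector_field M -> vector_field M)
    X Y Z W : levi_civita g nabla ->
  metric_app g (curvature nabla X Y Z) W
    + metric_app g Z (curvature nabla X Y W) = 0.
Proof.
move=> lc; have gE := lc_metric lc.
have := vf_app_bracket X Y (metric_app g Z W).
rewrite !gE !vf_appD !gE /curvature !metricBl !metricBr => /eqP.
rewrite -subr_eq0 => /eqP E; rewrite -[RHS]oppr0 -E; ring.
Qed.

End Metric.

Section StructureFields.
Context {R : realType} {m : nat} {M : manifold R (2 * m + 2)}.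
Context {f : tensor11 M} {xi : 'I_2 -> vector_field M}.
Context {eta : 'I_2 -> one_form M} {g : riemannian_metric M}.
Hypothesis hf : metric_f_structure f xi eta g.

(** The compatibility of g with f, applied to f xi_b = 0, leaves only the
    eta-part of the metric. *)
Lemma metric_xi a b : metric_app g (xi a) (xi b) = (a == b)%:R.
Proof.
rewrite (mf_compat hf) !(mf_f_xi hf) metric0l add0r (bigD1 a) //= big1 => [|c nca].
  by rewrite !(mf_dual hf) eqxx mul1r addr0.
by rewrite (mf_dual hf) (negPf nca) mul0r.
Qed.

Variables F1 F2 F3 F4 F5 F6 F7 F8 : C^oo(M).
Let RS := gen_S_space_form_curvature f xi eta g F1 F2 F3 F4 F5 F6 F7 F8.

(** On the structure fields f vanishes and every coefficient is a product of
    Kronecker deltas; two F_5 terms survive in the first value and two F_6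
    terms in the second, with opposite signs. *)
Lemma gen_S_xi12 :
  RS (xi 0) (xi 1) (xi 1) = (F1 - F3 - F4 + F7) *: xi 0 /\
  RS (xi 0) (xi 1) (xi 0) = - (F1 - F3 - F4 + F8) *: xi 1.
Proof.
rewrite /RS /gen_S_space_form_curvature !(mf_dual hf, mf_f_xi hf, metric_xi) /=.
rewrite !(metric0l, metric0r, mul0r, mulr0, mul1r, scale0r, scaler0, scale1r).
rewrite !(add0r, addr0, sub0r, subr0, oppr0, subrr, addNr, mulr0, scaler0,
  scale0r).
by split; rewrite !scalerN ?opprD ?opprK !scalerDl ?scaleNr.
Qed.

End StructureFields.

Theorem theorem1p1 (R : realType) (m : nat) (M : manifold R (2 * m + 2))
    (f : tensor11 M) (xi : 'I_2 -> vector_field M) (eta : 'I_2 -> one_form M)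
    (g : riemannian_metric M)
    (nabla : vector_field M -> vector_field M -> vector_field M)
    (F1 F2 F3 F4 F5 F6 F7 F8 : C^oo(M))
    (hf : metric_f_structure f xi eta g)
    (hnabla : levi_civita g nabla)
    (hR : forall X Y Z : vector_field M,
      curvature nabla X Y Z =
      gen_S_space_form_curvature f xi eta g F1 F2 F3 F4 F5 F6 F7 F8 X Y Z) :
  F7 = F8.
Proof.
have := curvature_skew g nabla (xi 0) (xi 1) (xi 1) (xi 0) hnabla.
have [R122 R121] := gen_S_xi12 hf F1 F2 F3 F4 F5 F6 F7 F8.
rewrite !hR R122 R121 [metric_app g (xi 1) _]metricC.
rewrite !metricZl !(metric_xi hf) !eqxx !mulr1 => /eqP.
by rewrite subr_eq0 => /eqP /addrI.
Qed.
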